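(* Let $f:\mathbb{GA}_N\rightarrow\mathbb{G\overline A}_N$ be an equitorsion second type almost geodesic mapping (of the $\theta$-th kind, $\theta\in\{1,2\}$) which satisfies the property of reciprocity, with determining objects $\psi_j,\sigma_j,F^i_j$. Put $F=F^\alpha_\alpha$ and $$\begin{aligned}\omega^i_{jk}=&-\tfrac12(\sigma_jF^i_k+\sigma_kF^i_j)+\tfrac1{N+1}\big(L^\alpha_{j\alpha}\delta^i_k+L^\alpha_{k\alpha}\delta^i_j\big)\\&+\tfrac1{2(N+1)}\Big(\big(\sigma_jF+\sigma_\alpha F^\alpha_j\big)\delta^i_k+\big(\sigma_kF+\sigma_\alpha F^\alpha_k\big)\delta^i_j\Big),\end{aligned}$$ and let $\overline\omega^i_{jk}$ be given by the same formula with $L^i_{jk},\sigma_j,F^i_j$ replaced by $\overline L^i_{jk},\overline\sigma_j,\overline F^i_j$, where $\overline\sigma_j=-\sigma_j$ and $\overline F^i_j=F^i_j$. Then the object $$\mathcal T^i_{jk}=L^i_{jk}-\omega^i_{jk}$$ is an invariant of the mapping $f$; that is, $\overline{\mathcal T}^i_{jk}=\mathcal T^i_{jk}$, where $\overline{\mathcal T}^i_{jk}=\overline L^i_{jk}-\overline\omega^i_{jk}$.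
   Context: A non-symmetric affine connection space $\mathbb{GA}_N$ is an $N$-dimensional manifold with an affine connection whose coefficients $L^i_{jk}$ need not be symmetric in $j,k$. Its symmetric part and torsion are $\widetilde S^i_{jk}=\frac12(L^i_{jk}+L^i_{kj})$ and $\widetilde T^i_{jk}=\frac12(L^i_{jk}-L^i_{kj})$. Objects of $\mathbb{G\overline A}_N$ carry a bar. All equations are in a coordinate system common with respect to the mapping $f$ (corresponding points have equal coordinates). The summation convention is used, and a comma denotes a partial derivative. Covariant derivatives of the first and second kind in $\mathbb{GA}_N$: $a^i_{j\underset1|k}=a^i_{j,k}+L^i_{\alpha k}a^\alpha_j-L^\alpha_{jk}a^i_\alpha$ and $a^i_{j\underset2|k}=a^i_{j,k}+L^i_{k\alpha}a^\alpha_j-L^\alpha_{kj}a^i_\alpha$. A mapping $f:\mathbb{GA}_N\to\mathbb{G\overline A}_N$ is a second type almost geodesic mapping of the $\theta$-th kind, $\theta=1,2$, if there are covectors $\psi_j,\sigma_j,\mu_j,\nu_j$, an affinor (a $(1,1)$-tensor) $F^i_j$ and a tensor $\xi^i_{jk}$ anti-symmetric in $j,k$ with $$\overline L^i_{jk}=L^i_{jk}+\psi_j\delta^i_k+\psi_k\delta^i_j+\sigma_jF^i_k+\sigma_kF^i_j+\xi^i_{jk},$$ $$F^i_{j\underset\theta|k}+F^i_{k\underset\theta|j}+F^i_\alpha F^\alpha_j\sigma_k+F^i_\alpha F^\alpha_k\sigma_j+(-1)^\theta\big(\xi^i_{j\alpha}F^\alpha_k+\xi^i_{k\alpha}F^\alpha_j\big)=\mu_jF^i_k+\mu_kF^i_j+\nu_j\delta^i_k+\nu_k\delta^i_j.$$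 It is equitorsion if $\widetilde{\overline T}{}^i_{jk}=\widetilde T^i_{jk}$, i.e. $\xi^i_{jk}=0$. It satisfies the property of reciprocity if it preserves $F^i_j$ and its inverse is a second type almost geodesic mapping of the $\theta$-th kind; this is equivalent to $F^i_\alpha F^\alpha_j=e\delta^i_j$ with $e\in\{0,1,-1\}$. In that case the objects determining $f^{-1}$ are $\overline\psi_j=-\psi_j$, $\overline\sigma_j=-\sigma_j$, $\overline F^i_j=F^i_j$. *)

(* Defs.v *)
From HB Require Import structures.
From mathcomp Require Import all_boot all_order all_algebra.
From mathcomp Require Import all_classical all_reals all_analysis.

Set Implicit Arguments.
Unset Strict Implicit.
Unset Printing Implicit Defensive.

Import Order.TTheory GRing.Theory Num.Theory.
Import numFieldNormedType.Exports.

Local Open Scope classical_set_scope.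
Local Open Scope ring_scope.

(* MathComp-Analysis has no manifolds: smooth manifolds and the few tensor
   fields needed are set up here by charts and components, with the classical
   transformation laws. *)

(** * Smooth functions on open subsets of R^n *)

Definition pderiv (R : realType) (n : nat) (k : 'I_n) (g : 'rV[R]_n -> R) :
    'rV[R]_n -> R :=
  fun x => 'D_(delta_mx 0 k) (g : 'rV[R]_n -> R^o) x.

(* C^oo on the open set U: all iterated partial derivatives exist and are
   continuous on U. *)
Definition smooth_on (R : realType) (n : nat) (U : set 'rV[R]_n)
    (g : 'rV[R]_n -> R) : Prop :=
  forall (s : seq 'I_n) (x : 'rV[R]_n), U x ->
    {for x, continuous (foldr (@pderiv R n) g s)} /\
    forall k : 'I_n,
      derivable (foldr (@pderiv R n) g s : 'rV[R]_n -> R^o) x (delta_mx 0 k).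

(** * Smooth manifolds *)

(* [coord] and [param] are total functions; only their values on [dom] and on
   [coord @` dom] are meaningful. *)
Record chart (R : realType) (n : nat) (M : topologicalType) := Chart {
  dom : set M;
  coord : M -> 'rV[R]_n;
  param : 'rV[R]_n -> M;
  dom_open : open dom;
  codom_open : open (coord @` dom);
  coordK : {in dom, cancel coord param};
  coord_continuous : {within dom, continuous coord};
  param_continuous : {within coord @` dom, continuous param} }.

Definition smooth_transition (R : realType) (n : nat) (M : topologicalType)
    (c c' : chart R n M) : Prop :=
  forall i : 'I_n,
    smooth_on (coord c @` (dom c `&` dom c')) (fun x => coord c' (param c x) 0 i).

Definition compatible (R : realType) (n : nat) (M : topologicalType)
    (c c' : chart R n M) : Prop :=
  smooth_transition c c' /\ smooth_transition c' c.

Record manifold (R : realType) (n : nat) := Manifold {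
  mcarrier :> topologicalType;
  atlas : set (chart R n mcarrier);
  mhausdorff : hausdorff_space mcarrier;
  msecond_countable : @second_countable mcarrier;
  atlas_cover : forall p : mcarrier, exists2 c, atlas c & dom c p;
  atlas_compatible : forall c c', atlas c -> atlas c' -> compatible c c';
  atlas_maximal : forall c,
    (forall c', atlas c' -> compatible c c') -> atlas c }.

(* Partial derivative, in the chart c and at the point p, of a function on M
   with respect to the k-th coordinate. *)
Definition pd (R : realType) (n : nat) (M : topologicalType) (c : chart R n M)
    (k : 'I_n) (g : M -> R) (p : M) : R :=
  pderiv k (g \o param c) (coord c p).

(* [jac c c' i a p] is dx'^i/dx^a at p, for x and x' the coordinates of c, c'. *)
Definition jac (R : realType) (n : nat) (M : topologicalType)
    (c c' : chart R n M) (i a : 'I_n) (p : M) : R :=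
  pd c a (fun q => coord c' q 0 i) p.

(* [hess c c' i a b p] is d^2x'^i/dx^a dx^b at p. *)
Definition hess (R : realType) (n : nat) (M : topologicalType)
    (c c' : chart R n M) (i a b : 'I_n) (p : M) : R :=
  pd c b (pd c a (fun q => coord c' q 0 i)) p.

Definition smooth_in (R : realType) (n : nat) (M : topologicalType)
    (c : chart R n M) (g : M -> R) : Prop :=
  smooth_on (coord c @` dom c) (g \o param c).

(** * Tensor fields and connections, given by their components in each chart *)

(* Throughout, the upper index comes first. *)

Record covector (R : realType) (n : nat) (M : manifold R n) := Covector {
  cov_comp :> chart R n M -> 'I_n -> M -> R;
  cov_smooth : forall c, atlas c -> forall j, smooth_in c (cov_comp c j);
  cov_law : forall c c', atlas c -> atlas c' ->
    forall p, dom c p -> dom c' p -> forall j,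
    cov_comp c' j p = \sum_b jac c' c b j p * cov_comp c b p }.

Record affinor (R : realType) (n : nat) (M : manifold R n) := Affinor {
  aff_comp :> chart R n M -> 'I_n -> 'I_n -> M -> R;
  aff_smooth : forall c, atlas c -> forall i j, smooth_in c (aff_comp c i j);
  aff_law : forall c c', atlas c -> atlas c' ->
    forall p, dom c p -> dom c' p -> forall i j,
    aff_comp c' i j p =
      \sum_a \sum_b jac c c' i a p * jac c' c b j p * aff_comp c a b p }.

Record tensor12 (R : realType) (n : nat) (M : manifold R n) := Tensor12 {
  t12_comp :> chart R n M -> 'I_n -> 'I_n -> 'I_n -> M -> R;
  t12_smooth : forall c, atlas c ->
    forall i j k, smooth_in c (t12_comp c i j k);
  t12_law : forall c c', atlas c -> atlas c' ->
    forall p, dom c p -> dom c' p -> forall i j k,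
    t12_comp c' i j k p =
      \sum_a \sum_b \sum_d
        jac c c' i a p * jac c' c b j p * jac c' c d k p * t12_comp c a b d p }.

(* No symmetry in the two lower indices is assumed. *)
Record connection (R : realType) (n : nat) (M : manifold R n) := Connection {
  conn_comp :> chart R n M -> 'I_n -> 'I_n -> 'I_n -> M -> R;
  conn_smooth : forall c, atlas c ->
    forall i j k, smooth_in c (conn_comp c i j k);
  conn_law : forall c c', atlas c -> atlas c' ->
    forall p, dom c p -> dom c' p -> forall i j k,
    conn_comp c' i j k p =
      \sum_a jac c c' i a p *
        (\sum_b \sum_d jac c' c b j p * jac c' c d k p * conn_comp c a b d p
         + hess c' c a j k p) }.

(* The space GA_N. *)
Record ga_space (R : realType) (n : nat) := GASpace {
  ga_manifold :> manifold R n;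
  ga_conn : connection ga_manifold }.

Definition torsion (R : realType) (n : nat) (A : ga_space R n)
    (c : chart R n A) (i j k : 'I_n) (p : A) : R :=
  2^-1 * (ga_conn A c i j k p - ga_conn A c i k j p).

(* Covariant derivatives of the first and second kind of an affinor; the
   last index is the index of differentiation. *)
Definition covd1 (R : realType) (n : nat) (A : ga_space R n) (F : affinor A)
    (c : chart R n A) (i j k : 'I_n) (p : A) : R :=
  pd c k (F c i j) p
  + \sum_a ga_conn A c i a k p * F c a j p
  - \sum_a ga_conn A c a j k p * F c i a p.

Definition covd2 (R : realType) (n : nat) (A : ga_space R n) (F : affinor A)
    (c : chart R n A) (i j k : 'I_n) (p : A) : R :=
  pd c k (F c i j) p
  + \sum_a ga_conn A c i k a p * F c a j p
  - \sum_a ga_conn A c a k j p * F c i a p.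

Definition covd (R : realType) (n : nat) (A : ga_space R n) (theta : nat) :=
  if theta == 1%N then @covd1 R n A else @covd2 R n A.

(** * Mappings *)

Definition smooth_map (R : realType) (n : nat) (M M' : manifold R n)
    (f : M -> M') : Prop :=
  continuous f /\
  forall c c', atlas c -> atlas c' -> forall i : 'I_n,
    smooth_on (coord c @` (dom c `&` f @^-1` dom c'))
              (fun x => coord c' (f (param c x)) 0 i).

Record diffeo (R : realType) (n : nat) (M M' : manifold R n) := Diffeo {
  dfun :> M -> M';
  dinv : M' -> M;
  dfunK : cancel dfun dinv;
  dinvK : cancel dinv dfun;
  dfun_smooth : smooth_map dfun;
  dinv_smooth : smooth_map dinv }.

Definition diffeo_inv (R : realType) (n : nat) (M M' : manifold R n)
    (f : diffeo M M') : diffeo M' M :=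
  Diffeo (dinvK f) (dfunK f) (dinv_smooth f) (dfun_smooth f).

(* Coordinate systems common with respect to f: corresponding points have
   equal coordinates. *)
Definition common (R : realType) (n : nat) (M M' : manifold R n)
    (f : diffeo M M') (c : chart R n M) (c' : chart R n M') : Prop :=
  [/\ atlas c, atlas c', dom c' = f @` dom c
    & forall p, dom c p -> coord c' (f p) = coord c p].

Definition delta (R : realType) (n : nat) (i j : 'I_n) : R := (i == j)%:R.

(* f is a second type almost geodesic mapping of the theta-th kind, with
   determining objects psi, sigma and F. *)
Definition almost_geodesic2 (R : realType) (n : nat) (theta : nat)
    (A A' : ga_space R n) (f : diffeo A A')
    (psi sigma : covector A) (F : affinor A) : Prop :=
  exists (mu nu : covector A) (xi : tensor12 A),
    (forall c, atlas c -> forall p, dom c p ->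
       forall i j k, xi c i j k p = - xi c i k j p) /\
    forall c c', common f c c' -> forall p, dom c p -> forall i j k,
      ga_conn A' c' i j k (f p) =
        ga_conn A c i j k p
        + psi c j p * delta R i k + psi c k p * delta R i j
        + sigma c j p * F c i k p + sigma c k p * F c i j p
        + xi c i j k p
      /\
      covd theta F c i j k p + covd theta F c i k j p
      + (\sum_a F c i a p * F c a j p) * sigma c k p
      + (\sum_a F c i a p * F c a k p) * sigma c j p
      + (-1) ^+ theta *
          \sum_a (xi c i j a p * F c a k p + xi c i k a p * F c a j p)
      = mu c j p * F c i k p + mu c k p * F c i j p
        + nu c j p * delta R i k + nu c k p * delta R i j.

Definition equitorsion (R : realType) (n : nat) (A A' : ga_space R n)
    (f : diffeo A A') : Prop :=
  forall c c', common f c c' -> forall p, dom c p -> forall i j k,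
    torsion c' i j k (f p) = torsion c i j k p.

(* The affinor F' on the target is the image of F (equal components in common
   coordinates), and sigma' is the opposite of the image of sigma. *)
Definition same_affinor (R : realType) (n : nat) (M M' : manifold R n)
    (f : diffeo M M') (F : affinor M) (F' : affinor M') : Prop :=
  forall c c', common f c c' -> forall p, dom c p -> forall i j,
    F' c' i j (f p) = F c i j p.

Definition opp_covector (R : realType) (n : nat) (M M' : manifold R n)
    (f : diffeo M M') (sigma : covector M) (sigma' : covector M') : Prop :=
  forall c c', common f c c' -> forall p, dom c p -> forall j,
    sigma' c' j (f p) = - sigma c j p.

Definition reciprocity (R : realType) (n : nat) (theta : nat)
    (A A' : ga_space R n) (f : diffeo A A') (F : affinor A) : Prop :=
  exists (psi' sigma' : covector A') (F' : affinor A'),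
    same_affinor f F F' /\
    almost_geodesic2 theta (diffeo_inv f) psi' sigma' F'.

(** * The objects omega and T *)

Definition omega (R : realType) (n : nat) (A : ga_space R n)
    (sigma : covector A) (F : affinor A)
    (c : chart R n A) (i j k : 'I_n) (p : A) : R :=
  let L := ga_conn A in
  let trF := \sum_a F c a a p in
  - 2^-1 * (sigma c j p * F c i k p + sigma c k p * F c i j p)
  + n.+1%:R^-1 * ((\sum_a L c a j a p) * delta R i k
                  + (\sum_a L c a k a p) * delta R i j)
  + (2 * n.+1%:R)^-1 *
      ((sigma c j p * trF + \sum_a sigma c a p * F c a j p) * delta R i k
       + (sigma c k p * trF + \sum_a sigma c a p * F c a k p) * delta R i j).

Definition calT (R : realType) (n : nat) (A : ga_space R n)
    (sigma : covector A) (F : affinor A)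
    (c : chart R n A) (i j k : 'I_n) (p : A) : R :=
  ga_conn A c i j k p - omega sigma F c i j k p.

(* Main.v *)
Require Import Defs.
From mathcomp Require Import all_boot all_order all_algebra.
From mathcomp Require Import all_classical all_reals all_analysis.
From mathcomp Require Import ring.

Import GRing.Theory Num.Theory.

(** In common coordinates the basic equation of the mapping, stripped of its
    antisymmetric part [xi] by equitorsion ([equitorsion_conn]), reads
      L' - L = psi_j delta_ik + psi_k delta_ij + sigma_j F_ik + sigma_k F_ij.
    Contracting [i] with [k] ([equitorsion_conn_trace]) gives
      tr L'_j - tr L_j = (N + 1) psi_j + sigma_j tr F + sigma_a F_aj,
    so that [psi] is determined by [sigma], [F] and the traces of the two
    connections. Once [psi] is eliminated, L' - L is a target expression minus
    the same source expression: the traces already occur as a difference, and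
    since [sigma] changes sign under the mapping while [F] is preserved, a term
    S linear in [sigma] is the difference of S / 2 on the target and - S / 2 on
    the source. The expression so obtained is [omega]. *)

Local Open Scope ring_scope.

(** The symmetric terms of the basic equation cancel in the torsion, so the
    difference of the torsions is [xi] itself, and equitorsion kills it. *)
Lemma equitorsion_conn (R : realType) (N theta : nat) (A A' : ga_space R N)
    (f : diffeo A A') (psi sigma : covector A) (F : affinor A)
    (c : chart R N A) (c' : chart R N A') (p : A) :
  almost_geodesic2 theta f psi sigma F -> equitorsion f ->
  common f c c' -> dom c p ->
  forall i j k : 'I_N,
    ga_conn A' c' i j k (f p) =
      ga_conn A c i j k p
      + psi c j p * delta R i k + psi c k p * delta R i j
      + sigma c j p * F c i k p + sigma c k p * F c i j p.
Proof.
move=> [mu [nu [xi [xi_anti basic_eq]]]] eqtor cc' cp i j k.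
have [atlas_c _ _ _] := cc'.
have [Ljk _] := basic_eq _ _ cc' _ cp i j k.
have [Lkj _] := basic_eq _ _ cc' _ cp i k j.
have xi_kj := xi_anti _ atlas_c _ cp i k j.
have tor := eqtor _ _ cc' _ cp i j k.
have xi0 : xi c i j k p = 0.
  have -> : xi c i j k p = torsion c' i j k (f p) - torsion c i j k p.
    by rewrite /torsion Ljk Lkj xi_kj; field.
  by rewrite tor subrr.
by rewrite Ljk xi0 addr0.
Qed.

Lemma sum_mulr_delta (R : realType) (N : nat) (g : 'I_N -> R) (j : 'I_N) :
  \sum_a g a * delta R a j = g j.
Proof.
rewrite (bigD1 j) //= /delta eqxx mulr1 big1 ?addr0 // => a /negPf ->.
exact: mulr0.
Qed.

(** The coefficient [N + 1] of [psi] arises as the trace [N] of the identity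
    plus one from the term where the delta carries the free index; being
    invertible, it lets [psi] be solved for. *)
Lemma equitorsion_conn_trace (R : realType) (N theta : nat)
    (A A' : ga_space R N)
    (f : diffeo A A') (psi sigma : covector A) (F : affinor A)
    (c : chart R N A) (c' : chart R N A') (p : A) :
  almost_geodesic2 theta f psi sigma F -> equitorsion f ->
  common f c c' -> dom c p ->
  forall j : 'I_N,
    \sum_a ga_conn A' c' a j a (f p) =
      \sum_a ga_conn A c a j a p + N.+1%:R * psi c j p
      + (sigma c j p * \sum_a F c a a p + \sum_a sigma c a p * F c a j p).
Proof.
move=> ag eqtor cc' cp j.
have connE := @equitorsion_conn
  R N theta A A' f psi sigma F c c' p ag eqtor cc' cp.
under eq_bigr do rewrite connE.
have tr_delta : \sum_(a < N) delta R a a = N%:R.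
  under eq_bigr do rewrite /delta eqxx.
  by rewrite sumr_const card_ord.
rewrite !big_split /= sum_mulr_delta -!mulr_sumr tr_delta -(natr1 N); ring.
Qed.

Theorem lemma2p1 (R : realType) (N : nat) (theta : nat)
    (A A' : ga_space R N) (f : diffeo A A')
    (psi sigma : covector A) (F : affinor A)
    (sigma' : covector A') (F' : affinor A') :
  theta = 1%N \/ theta = 2%N ->
  almost_geodesic2 theta f psi sigma F ->
  equitorsion f ->
  reciprocity theta f F ->
  opp_covector f sigma sigma' ->
  same_affinor f F F' ->
  forall (c : chart R N A) (c' : chart R N A'), common f c c' ->
  forall p : A, dom c p ->
  forall i j k : 'I_N,
    calT sigma' F' c' i j k (f p) = calT sigma F c i j k p.
Proof.
move=> _ ag eqtor _ opp_sigma same_F c c' cc' p cp i j k.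
have connE := @equitorsion_conn
  R N theta A A' f psi sigma F c c' p ag eqtor cc' cp.
have traceE := @equitorsion_conn_trace
  R N theta A A' f psi sigma F c c' p ag eqtor cc' cp.
have F'E := same_F _ _ cc' _ cp.
have sigma'E := opp_sigma _ _ cc' _ cp.
have trF' : \sum_a F' c' a a (f p) = \sum_a F c a a p.
  by apply: eq_bigr => a _; exact: F'E.
have sF' l : \sum_a sigma' c' a (f p) * F' c' a l (f p)
           = - \sum_a sigma c a p * F c a l p.
  by rewrite -sumrN; apply: eq_bigr => a _; rewrite sigma'E F'E mulNr.
have N1_neq0 : 1 + N%:R != 0 :> R by rewrite nat1r pnatr_eq0.
rewrite /calT /omega trF' !sF' !F'E !sigma'E.
rewrite !traceE connE.
by field.
Qed.
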